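(* Let $G$ be a totally disconnected locally compact group, let $\alpha_1,\dots,\alpha_n$ be a sequence of automorphisms of $G$, and suppose that $U$ is a compact open subgroup of $G$ which is invariably tidy for $\{\alpha_1,\dots,\alpha_n\}$. For each $\epsilon\in\{-1,1\}^{\{1,\dots,n\}}$ put $\mathfrak{a}_\epsilon=\{\alpha_j^{\epsilon(j)} : j\in\{1,\dots,n\}\}$. Then $$U=\prod_{\epsilon\in\{-1,1\}^{\{1,\dots,n\}}} U_{\mathfrak{a}_\epsilon},$$ where the factors in the product are written in the lexicographic order on $\{-1,1\}^{\{1,\dots,n\}}$ (with $-1<1$). Moreover, for each $j\in\{1,\dots,n\}$ and each $\epsilon$, we have $\alpha_j(U_{\mathfrak{a}_\epsilon})\ge U_{\mathfrak{a}_\epsilon}$ if $\alpha_j\in\mathfrak{a}_\epsilon$, and $\alpha_j(U_{\mathfrak{a}_\epsilon})\le U_{\mathfrak{a}_\epsilon}$ if $\alpha_j^{-1}\in\mathfrak{a}_\epsilon$.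
   Context: $\mathrm{Aut}(G)$ is the group of automorphisms of the topological group $G$ (continuous with continuous inverse); automorphisms of $G$ are elements of $\mathrm{Aut}(G)$. A compact open subgroup $V$ of $G$ is tidy for $\alpha\in\mathrm{Aut}(G)$ if $[\alpha(V'):\alpha(V')\cap V']$, as $V'$ ranges over all compact open subgroups of $G$, is minimised at $V'=V$. It is known that $V$ is tidy for $\alpha$ if and only if (T1) $V=V_{\alpha+}V_{\alpha-}$, where $V_{\alpha\pm}=\bigcap_{n\ge 0}\alpha^{\pm n}(V)$, and (T2) $\bigcup_{n\ge 0}\alpha^n(V_{\alpha+})$ is closed. A compact open subgroup $U$ is invariably tidy for a finite set $\mathfrak{a}$ of automorphisms if for every $\gamma$ in the group $\langle\mathfrak{a}\rangle$ generated by $\mathfrak{a}$, $\gamma(U)$ is tidy for each $\alpha\in\mathfrak{a}$. For a finite set $\mathfrak{a}$ of automorphisms, $U_{\mathfrak{a}}:=\bigcap_{\alpha\in\mathfrak{a}}U_{\alpha+}$ with $U_{\alpha+}=\bigcap_{k\ge 0}\alpha^k(U)$. The product of subgroups means the set of products of elements taken in the indicated order. The order used is the lexicographic one in which the coordinate with index $1$ is most significant. *)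

(* Defs.v *)
From HB Require Import structures.
From mathcomp Require Import all_boot all_order.
From mathcomp Require Import all_classical topology.

Set Implicit Arguments.
Unset Strict Implicit.
Unset Printing Implicit Defensive.

Local Open Scope classical_set_scope.
Local Open Scope group_scope.

HB.mixin Record Group_isTopologicalGroup G of Group G & Topological G := {
  mulg_continuous : continuous (fun xy : G * G => xy.1 * xy.2) ;
  invg_continuous : continuous (fun x : G => x^-1)
}.

#[short(type="topologicalGroupType")]
HB.structure Definition TopologicalGroup :=
  {G of Group G & Topological G & Group_isTopologicalGroup G}.

(** The group [Aut G] of bicontinuous automorphisms; the product is composition,
    [(a * b) x = a (b x)]. *)
Section Automorphisms.
Variable G : topologicalGroupType.

Record aut := Aut {
  aut_fun :> G -> G ;
  aut_inv : G -> G ;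
  aut_funK : cancel aut_fun aut_inv ;
  aut_invK : cancel aut_inv aut_fun ;
  autM : {morph aut_fun : x y / x * y} ;
  aut_continuous : continuous aut_fun ;
  aut_inv_continuous : continuous aut_inv
}.

Lemma aut_eq (a b : aut) : (forall x, a x = b x) -> a = b.
Proof.
case: a b => [f f' fK f'K fM fc f'c] [g g' gK g'K gM gc g'c] /= fg.
have {}fg : f = g by exact/funext.
have f'g' : f' = g' by apply/funext => x; rewrite -{1}(g'K x) -fg fK.
by subst g g'; congr Aut; exact: Prop_irrelevance.
Qed.

Definition aut_one : aut :=
  @Aut id id (fun=> erefl) (fun=> erefl) (fun _ _ => erefl)
    (fun=> cvg_id) (fun=> cvg_id).

Lemma aut_invM (a : aut) : {morph aut_inv a : x y / x * y}.
Proof.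
by move=> x y; rewrite -{1}(aut_invK a x) -{1}(aut_invK a y) -autM aut_funK.
Qed.

Definition aut_inverse (a : aut) : aut :=
  Aut (aut_invK a) (aut_funK a) (@aut_invM a) (@aut_inv_continuous a)
    (@aut_continuous a).

Definition aut_mul (a b : aut) : aut.
Proof.
apply: (@Aut (a \o b) (aut_inv b \o aut_inv a)).
- exact: can_comp (aut_funK a) (aut_funK b).
- exact: can_comp (aut_invK b) (aut_invK a).
- by move=> x y /=; rewrite !autM.
- by move=> x; apply: continuous_comp; exact: aut_continuous.
- by move=> x; apply: continuous_comp; exact: aut_inv_continuous.
Defined.

HB.instance Definition _ := gen_eqMixin aut.
HB.instance Definition _ := gen_choiceMixin aut.

Lemma aut_mulA : associative aut_mul.
Proof. by move=> a b c; exact: aut_eq. Qed.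
Lemma aut_mul1 : left_id aut_one aut_mul.
Proof. by move=> a; exact: aut_eq. Qed.
Lemma aut_mulr1 : right_id aut_one aut_mul.
Proof. by move=> a; exact: aut_eq. Qed.
Lemma aut_mulV : left_inverse aut_one aut_inverse aut_mul.
Proof. by move=> a; apply: aut_eq => x /=; rewrite aut_funK. Qed.
Lemma aut_mulrV : right_inverse aut_one aut_inverse aut_mul.
Proof. by move=> a; apply: aut_eq => x /=; rewrite aut_invK. Qed.

HB.instance Definition _ :=
  isGroup.Build aut aut_mulA aut_mul1 aut_mulr1 aut_mulV aut_mulrV.

End Automorphisms.

Section Subgroups.
Variable G : groupType.

Definition is_subgroup (H : set G) : Prop :=
  [/\ H 1, forall x y, H x -> H y -> H (x * y) & forall x, H x -> H x^-1].

Definition generated_subgroup (A : set G) : set G :=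
  \bigcap_(H in [set H | is_subgroup H /\ A `<=` H]) H.

Definition set_mulg (A B : set G) : set G :=
  [set x * y | x in A & y in B].

Definition left_cosets (K H : set G) : set (set G) :=
  [set [set x * h | h in H] | x in K].

End Subgroups.

Section Tidy.
Variable G : topologicalGroupType.
Implicit Types (V U : set G) (a : aut G) (A : set (aut G)).

Definition compact_open_subgroup V : Prop :=
  [/\ is_subgroup V, compact V & open V].

(** The index [[a(V) : a(V) `&` V]] is the cardinal of this set, and indices are
    compared as cardinals; finiteness (automatic, [V] being compact open) is not
    needed for minimality to make sense. *)
Definition displacement_cosets a V : set (set G) :=
  left_cosets (a @` V) (a @` V `&` V).

Definition tidy a V : Prop :=
  compact_open_subgroup V /\
  forall V', compact_open_subgroup V' ->
    (displacement_cosets a V #<= displacement_cosets a V')%card.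

Definition invariably_tidy A U : Prop :=
  compact_open_subgroup U /\
  forall c, generated_subgroup A c -> forall a, A a -> tidy a (c @` U).

Definition aut_plus a U : set G := \bigcap_(k : nat) ((a ^+ k) @` U).

(** For empty [A] this is the whole group [G], not [U]. *)
Definition aut_plus_inter A U : set G := \bigcap_(a in A) aut_plus a U.

End Tidy.

(** A sign vector in [{-1,1}^n] is a boolean tuple, [true] standing for [1] and
    [false] for [-1]. The lexicographic order of [n.-tuplelexi bool] has
    [false < true] and entry [0] most significant. *)
Definition signs (n : nat) := n.-tuplelexi bool.

Definition signs_lex (n : nat) : seq (signs n) :=
  sort <=%O (enum {: signs n}).

Definition signed_auts (G : topologicalGroupType) (n : nat)
    (alpha : 'I_n -> aut G) (e : signs n) : set (aut G) :=
  [set (if tnth e j then alpha j else (alpha j)^-1) | j in [set: 'I_n]].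

(* Main.v *)
From HB Require Import structures.
Require Import Defs.
From mathcomp Require Import all_boot all_order.
From mathcomp Require Import all_classical topology.

Set Implicit Arguments.
Unset Strict Implicit.
Unset Printing Implicit Defensive.

Local Open Scope classical_set_scope.
Local Open Scope group_scope.

Import Order.TTheory.

#[local] Arguments aut_fun : simpl never.

(** Write [V+] for the elements of [V] whose whole backward [a]-orbit lies in
    [V] (this is [stays a^-1 V], and [aut_plus a V]), [V-] for the analogous
    forward set [stays a V], and [V_n] for the intersection of [a^k(V)] over
    [0 <= k <= n] ([trunc a V n]).

    The theorem rests on two properties of a subgroup [V] tidy for [a], which
    are gathered in the record [splits]:
    - factorization: [V = V+ V-];
    - capture: an element of [V] with relatively compact backward (forward)
      orbit lies in [V+] (in [V-]).

    Both must be extracted from minimality of the displacement index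
    [[a(V) : a(V) cap V]]. Comparing [V] with the subgroups [V_n] forces
    [a(V) = (a(V_n)) (a(V) cap V)], and compactness turns this into
    [V = V+ V-] ([minimal_factor]). Capture follows, by recurrence in compact
    sets ([convex_bounded]), from convexity of orbits: if [x] and [a^n x] are in
    [V] then so is everything in between ([minimal_convex]). For convexity one
    builds from [V] another compact open subgroup [Z] whose indices
    [[a^n(Z) : a^n(Z) cap Z]] are at least [t^n], where [t] bounds that of [Z]
    for [n = 1], hence by minimality that of [V] ([exact_growth_subgroup]); here
    [Z = W L], where [L]
    is the relatively compact group of elements whose orbits are in [V] at all
    large times, positive and negative, and [W] is a subgroup of [V] normalized
    by [L] and of minimal displacement. If [V] were not convex, some index
    [[a^n(V) : a^n(V) cap V]] would be less than [t^n], hence the indices for [V]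
    would grow at a strictly smaller exponential rate than those for [Z], which
    is absurd since [V] and [Z] are commensurable.

    The two properties together, unlike minimality, pass easily to
    intersections ([splitsI]): two factorizations [x = v- v+ = w- w+] of an
    element of [V cap W] differ by [g = w-^-1 v-], whose two-sided orbit is
    relatively compact; recurrence then writes [g = w0 v0] with [w0], [v0]
    having their full orbits in [W], [V], and this corrects the two
    factorizations to a common one.

    Now let [U] be invariably tidy. Every [c(U)] with [c] in the group generated
    by the [alpha j] splits for each [alpha j], hence so do their finite
    intersections, and by compactness a countable intersection [P] of such
    sets with [P] inside [U] satisfies
    [P = (P cap U-) (P cap U+)] ([cut_factor]). Applying this to one automorphism
    after another doubles the number of factors each time and produces them in
    lexicographic order ([cut_prod]). For the inclusions, let [x] be in [U_a] for
    a set [a] of automorphisms containing [alpha j], let [b] be in [a] and put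
    [V = b^k(U)]. The backward [alpha j]-orbit of [x] is relatively compact,
    being in [U], and [x] is in [V], so capture for [V] gives that
    [(alpha j)^-1 x] is in [V]. *)

(** * Subgroups and lists of coset representatives *)

Section CosetLists.
Variable G : groupType.
Implicit Types (A B H K : set G) (s t : seq G).

Lemma subg1 H : is_subgroup H -> H 1. Proof. by case. Qed.
Lemma subgM H x y : is_subgroup H -> H x -> H y -> H (x * y).
Proof. by case=> _ + _; exact. Qed.
Lemma subgV H x : is_subgroup H -> H x -> H x^-1.
Proof. by case=> _ _; exact. Qed.
Lemma subgVM H x y : is_subgroup H -> H x -> H y -> H (x^-1 * y).
Proof. by move=> sH Hx Hy; apply: subgM => //; exact: subgV. Qed.
Lemma subgVr H x : is_subgroup H -> H x^-1 -> H x.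
Proof. by move=> sH /(subgV sH); rewrite invgK. Qed.

Definition simplg := (@invgM, @invgK, @invg1, @mulgA, @mulgK, @mulgVK, @mulg1,
  @mul1g, @mulVg, @mulgV).

(** Indices are compared through finite lists: a list meeting every coset
    [x H] with [x] in [A] bounds the number of these cosets from above, a list
    of pairwise inequivalent elements of [A] bounds it from below. The set [A]
    need not contain [H], so that [[A : A cap H]] is covered as well. *)
Definition covers A H t := forall x, A x -> exists2 y, y \in t & H (y^-1 * x).

Definition distinct_cosets A H s :=
  [/\ uniq s, (forall x, x \in s -> A x)
    & forall x y, x \in s -> y \in s -> H (x^-1 * y) -> x = y].

Lemma distinct_le_covers A H s t : is_subgroup H ->
  distinct_cosets A H s -> covers A H t -> (size s <= size t)%N.
Proof.
move=> sH [us sA sepH] cA.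
have [f fP] : {f : G -> G & forall x, x \in s -> f x \in t /\ H ((f x)^-1 * x)}.
  apply: (@choice _ _ (fun x y => x \in s -> y \in t /\ H (y^-1 * x))) => x.
  have [xs|xs] := boolP (x \in s); last by exists x.
  by have [y yt Hy] := cA x (sA x xs); exists y.
rewrite -(size_map f) uniq_leq_size //; last first.
  by move=> _ /mapP[x xs ->]; have [] := fP x xs.
rewrite map_inj_in_uniq // => x y xs ys fxy; apply: sepH => //.
have [_ Hx] := fP x xs; have [_ Hy] := fP y ys.
by have := subgVM sH Hx Hy; rewrite fxy !simplg.
Qed.

Lemma covers_transversal A H t : is_subgroup H -> covers A H t ->
  exists s, [/\ distinct_cosets A H s, covers A H s & (size s <= size t)%N].
Proof.
move=> sH; elim: t A => [|y t IH] A cA.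
  by exists [::]; split=> // x /cA.
have [[x Ax Hx]|nAx] := pselect (exists2 x, A x & H (y^-1 * x)); last first.
  have [|s [sepA cAs les]] := IH A; last by exists s; split=> //; exact: leqW.
  move=> x Ax; have [z] := cA x Ax; rewrite inE => /orP[/eqP->|zt] Hz.
    by case: nAx; exists x.
  by exists z.
pose A' := A `&` [set z | ~ H (x^-1 * z)].
have [|s [[us sA sepA] cAs les]] := IH A'.
  move=> z [Az Hz]; have [w] := cA z Az; rewrite inE => /orP[/eqP->|wt] Hw;
    last by exists w.
  by case: Hz; have := subgVM sH Hx Hw; rewrite !simplg.
exists (x :: s); split=> //.
- split=> /=.
  + rewrite us andbT; apply/negP => /sA[_]; apply.
    by rewrite mulVg; exact: subg1.
  + by move=> z; rewrite inE => /orP[/eqP->|/sA[]].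
  + move=> z w; rewrite !inE => /orP[/eqP->|zs] /orP[/eqP->|ws] // Hzw.
    * by have [_ /(_ Hzw)] := sA w ws.
    * have [_ []] := sA z zs.
      by have := subgV sH Hzw; rewrite !simplg.
    * exact: sepA.
- move=> z Az; have [Hz|Hz] := pselect (H (x^-1 * z)).
    by exists x; rewrite ?mem_head.
  by have [//|w ws Hw] := cAs z; exists w => //; rewrite inE ws orbT.
Qed.

(** A list of inequivalent elements that is as long as a covering list is
    itself covering: a missed coset could be added to it. This is how equality
    of indices becomes equality of sets of cosets. *)
Lemma distinct_covers A H s t : is_subgroup H -> distinct_cosets A H s ->
  covers A H t -> (size t <= size s)%N -> covers A H s.
Proof.
move=> sH [us sA sepA] cA lets x Ax; apply: contrapT => nx.
suff /distinct_le_covers/(_ cA) : distinct_cosets A H (x :: s).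
  by move=> /(_ sH) /= /leq_trans/(_ lets); rewrite ltnn.
have Hx y : y \in s -> ~ H (y^-1 * x) by move=> ys Hy; apply: nx; exists y.
split=> /=.
- rewrite us andbT; apply/negP => /Hx; apply.
  by rewrite mulVg; exact: subg1.
- by move=> z; rewrite inE => /orP[/eqP->|/sA].
- move=> z w; rewrite !inE => /orP[/eqP->|zs] /orP[/eqP->|ws] // Hzw.
  + by case: (Hx w ws); have := subgV sH Hzw; rewrite !simplg.
  + by case: (Hx z zs).
  + exact: sepA.
Qed.

Lemma covers_sub A B H t : A `<=` B -> covers B H t -> covers A H t.
Proof. by move=> AB cB x /AB /cB. Qed.

Lemma covers_subr A H K t : H `<=` K -> covers A H t -> covers A K t.
Proof. by move=> HK cA x /cA[y yt /HK Ky]; exists y. Qed.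

Lemma covers_mul A B H t : covers A H t ->
  (forall x, B x -> exists2 y, A y & H (y^-1 * x)) -> is_subgroup H -> covers B H t.
Proof.
move=> cA BA sH x /BA[y /cA[z zt Hz] Hy]; exists z => //.
by have := subgM sH Hz Hy; rewrite !simplg.
Qed.

Lemma covers_tower A H K s t : covers A H s -> covers H K t ->
  covers A K [seq x * y | x <- s, y <- t].
Proof.
move=> cA cH x /cA[y ys] /cH[z zt Kz].
exists (y * z); first exact: allpairs_f.
by rewrite invgM -mulgA.
Qed.

End CosetLists.

(** * Iterates of automorphisms *)

Section Iterates.
Variable G : topologicalGroupType.
Implicit Types (a b : aut G) (x y : G) (A V : set G).

Lemma autK a x : a^-1 (a x) = x.
Proof. exact: aut_funK. Qed.
Lemma autVK a x : a (a^-1 x) = x.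
Proof. exact: aut_invK. Qed.
Lemma aut1 a : a 1 = 1.
Proof. by apply: (mulgI (a 1)); rewrite -autM !mulg1. Qed.
Lemma autV a x : a x^-1 = (a x)^-1.
Proof. by apply: (mulgI (a x)); rewrite -autM !mulgV aut1. Qed.

Lemma autXS a k x : (a ^+ k.+1) x = a ((a ^+ k) x).
Proof. by rewrite expgS. Qed.
Lemma autXSr a k x : (a ^+ k.+1) x = (a ^+ k) (a x).
Proof. by rewrite expgSr. Qed.
Lemma autXD a m n x : (a ^+ (m + n)) x = (a ^+ m) ((a ^+ n) x).
Proof. by rewrite expgnDr. Qed.
Lemma autXVK a n x : (a^-1 ^+ n) ((a ^+ n) x) = x.
Proof. by rewrite expVgn autK. Qed.
Lemma autXKV a n x : (a ^+ n) ((a^-1 ^+ n) x) = x.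
Proof. by rewrite expVgn autVK. Qed.
Lemma autXVD a m n x : (a^-1 ^+ (m + n)) ((a ^+ n) x) = (a^-1 ^+ m) x.
Proof. by rewrite autXD autXVK. Qed.
Lemma autXDV a m n x : (a ^+ (m + n)) ((a^-1 ^+ n) x) = (a ^+ m) x.
Proof. by rewrite autXD autXKV. Qed.
Lemma autXVDl a m n x : (a^-1 ^+ m) ((a ^+ (m + n)) x) = (a ^+ n) x.
Proof. by rewrite autXD autXVK. Qed.
Lemma autXDVl a m n x : (a ^+ m) ((a^-1 ^+ (m + n)) x) = (a^-1 ^+ n) x.
Proof. by rewrite autXD autXKV. Qed.

Lemma aut_imageE a A : a @` A = [set x | A (a^-1 x)].
Proof.
apply/seteqP; split=> x.
  by move=> [y Ay <-]; rewrite /mkset autK.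
by move=> Ax; exists (a^-1 x) => //; rewrite autVK.
Qed.
Lemma autX_imageE a k A : (a ^+ k) @` A = [set x | A ((a^-1 ^+ k) x)].
Proof. by rewrite aut_imageE expVgn. Qed.

Lemma subgroup_preim a V : is_subgroup V -> is_subgroup [set x | V (a x)].
Proof.
move=> sV; split=> [|x y|x] /=; rewrite ?aut1 ?autM ?autV.
- exact: subg1.
- exact: subgM.
- exact: subgV.
Qed.

Lemma subgroupI (V W : set G) :
  is_subgroup V -> is_subgroup W -> is_subgroup (V `&` W).
Proof.
move=> sV sW; split=> [|x y [Vx Wx] [Vy Wy]|x [Vx Wx]]; split.
all: by [exact: subg1 | exact: subgM | exact: subgV].
Qed.

End Iterates.

(** * Compactness in topological groups *)

Section GroupTopology.
Variable G : topologicalGroupType.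
Implicit Types (a b : aut G) (x y : G) (A B C H V : set G).

Lemma mulg_cvg (x y : G) (U : set G) : nbhs (x * y) U ->
  exists2 AB, nbhs x AB.1 /\ nbhs y AB.2 & forall u v, AB.1 u -> AB.2 v -> U (u * v).
Proof.
move=> /(@mulg_continuous G (x, y))[[A B] /= [Ax By] ABU].
by exists (A, B) => // u v Au Bv; exact: (ABU (u, v)).
Qed.

Lemma mulgl_continuous (y : G) : continuous (fun x : G => y * x).
Proof.
move=> x U /mulg_cvg[[A B] /= [Ay Bx] ABU].
by apply: filterS Bx => v Bv; apply: ABU => //; exact: nbhs_singleton.
Qed.

Lemma mulgr_continuous (y : G) : continuous (fun x : G => x * y).
Proof.
move=> x U /mulg_cvg[[A B] /= [Ax By] ABU].
by apply: filterS Ax => u Au; apply: ABU => //; exact: nbhs_singleton.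
Qed.

Lemma coset_nbhs H x : is_subgroup H -> open H -> nbhs x [set y | H (x^-1 * y)].
Proof.
move=> sH oH; apply: (mulgl_continuous (y := x^-1)).
by rewrite mulVg; apply: open_nbhs_nbhs; split=> //; exact: subg1.
Qed.

Lemma open_subgroup H : is_subgroup H -> nbhs 1 H -> open H.
Proof.
move=> sH H1; rewrite openE => x Hx; rewrite /interior.
have : nbhs x [set y | H (x^-1 * y)].
  by apply: (mulgl_continuous (y := x^-1)); rewrite mulVg.
by apply: filterS => y /= /(subgM sH Hx); rewrite mulVKg.
Qed.

Lemma open_subgroup_closed H : is_subgroup H -> open H -> closed H.
Proof.
move=> sH oH x /(_ _ (coset_nbhs x sH oH))[y [Hy /= Hxy]].
by apply: subgVr => //; have := subgM sH Hxy (subgV sH Hy); rewrite !simplg.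
Qed.

Lemma open_preim a V : open V -> open [set x | V (a x)].
Proof. by move=> oV; apply: (@open_comp _ _ a) => // x _; exact: aut_continuous. Qed.

Lemma closed_preim a V : closed V -> closed [set x | V (a x)].
Proof. by move=> oV; apply: (@closed_comp _ _ a) => // x _; exact: aut_continuous. Qed.

Lemma compact_preim a V : compact V -> compact [set x | V (a x)].
Proof.
move=> cV; rewrite -{1}(invgK a) -aut_imageE; apply: continuous_compact => //.
by apply: continuous_subspaceT; exact: aut_continuous.
Qed.

Lemma compact_mulg A B : compact A -> compact B -> compact (set_mulg A B).
Proof.
move=> cA cB.
have -> : set_mulg A B = (fun xy : G * G => xy.1 * xy.2) @` (A `*` B).
  apply/seteqP; split=> z.
    by move=> [x Ax [y By <-]]; exists (x, y).
  by move=> [[x y] [/= Ax By] <-]; exists x => //; exists y.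
apply: continuous_compact; last exact: compact_setX.
by apply: continuous_subspaceT; exact: mulg_continuous.
Qed.

Lemma compact_invg A : compact A -> compact [set x | A x^-1].
Proof.
move=> cA; have -> : [set x | A x^-1] = (fun x : G => x^-1) @` A.
  apply/seteqP; split=> z /=; first by move=> Az; exists z^-1; rewrite ?invgK.
  by move=> [x Ax <-]; rewrite invgK.
apply: continuous_compact => //.
by apply: continuous_subspaceT; exact: invg_continuous.
Qed.

(** Otherwise the sets [C] minus finitely many cosets of [H] would generate a
    proper filter; a cluster point [x] of it has the neighbourhood [x H], which
    avoids a member of the filter. *)
Lemma compact_covers C H : compact C -> is_subgroup H -> open H ->
  exists t, covers C H t.
Proof.
move=> cC sH oH; apply: contrapT => /forallNP nC.
pose rest (t : seq G) := C `&` [set x | forall y, y \in t -> ~ H (y^-1 * x)].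
pose F : set_system G := [set B | exists t, rest t `<=` B].
have PF : ProperFilter F.
  split.
    move=> [t t0]; apply: (nC t) => x Cx; apply: contrapT => nx.
    by apply: (t0 x); split=> // y yt Hy; apply: nx; exists y.
  split.
  - by exists [::].
  - move=> A B [s sA] [t tB]; exists (s ++ t) => x [Cx xst]; split.
      by apply: sA; split=> // y ys; apply: xst; rewrite mem_cat ys.
    by apply: tB; split=> // y ys; apply: xst; rewrite mem_cat ys orbT.
  - by move=> A B AB [t tA]; exists t; exact: subset_trans AB.
have [|x [Cx]] := cC F PF; first by exists [::] => x [].
have Fx : F (rest [:: x]) by exists [:: x].
move=> /(_ _ _ Fx (coset_nbhs x sH oH))[y [[_ /(_ x)]]].
by rewrite mem_head => /(_ isT).
Qed.

(** Recurrence: a cluster point [x] of the sequence has the neighbourhood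
    [x H], visited infinitely often. *)
Lemma compact_recurrence C H (u : nat -> G) : compact C -> is_subgroup H ->
  open H -> (forall n, C (u n)) ->
  exists n, forall M, exists2 m, (M <= m)%N & H ((u n)^-1 * u m).
Proof.
move=> cC sH oH Cu.
have [|x [Cx clx]] := cC (u @ \oo) _.
  by exists 0 => // n _; exact: Cu.
have often M : exists2 m, (M <= m)%N & H (x^-1 * u m).
  have FM : (u @ \oo) [set u m | m in [set m | (M <= m)%N]].
    by exists M => // m /= Mm; exists m.
  by have [_ [[m Mm <-] Hm]] := clx _ _ FM (coset_nbhs x sH oH); exists m.
have [n _ Hn] := often 0; exists n => M; have [m Mm Hm] := often M.
by exists m => //; have := subgVM sH Hn Hm; rewrite !simplg.
Qed.

(** Write [x = a_n b_n]; a cluster point [y] of [a_n] lies in every [A n], and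
    then [y^-1 x], a cluster point of [b_n], lies in every [B n]. All passages
    from finite to infinite intersections below go through this lemma. *)
Lemma compact_bigcap_mulg (A B : nat -> set G) x :
  compact (A 0) -> (forall n, closed (A n)) -> (forall n, closed (B n)) ->
  (forall m n, (m <= n)%N -> A n `<=` A m) ->
  (forall m n, (m <= n)%N -> B n `<=` B m) ->
  (forall n, set_mulg (A n) (B n) x) ->
  set_mulg (\bigcap_n A n) (\bigcap_n B n) x.
Proof.
move=> cA clA clB Am Bm ABx.
have [u uP] : {u : nat -> G & forall n, A n (u n) /\ B n ((u n)^-1 * x)}.
  apply: (@choice _ _ (fun n y => A n y /\ B n (y^-1 * x))) => n.
  by have [y Ay [z Bz <-]] := ABx n; exists y; rewrite mulKg.
have [|y [_ cly]] := cA (u @ \oo) _.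
  by exists 0 => // n _ /=; have [+ _] := uP n; exact: Am.
have FM M : (u @ \oo) [set u m | m in [set m | (M <= m)%N]].
  by exists M => // m /= Mm; exists m.
exists y => [n _|].
  apply: clA => N /(cly _ _ (FM n))[_ [[m /= nm <-] Nm]].
  by exists (u m); split=> //; have [+ _] := uP m; exact: Am.
exists (y^-1 * x); last by rewrite mulVKg.
move=> n _; apply: clB => N Ny.
have : nbhs y [set z | N (z^-1 * x)].
  have [[P Q] /= [Py Qx] PQN] := mulg_cvg Ny.
  have iP : nbhs y [set z | P z^-1] by exact: (@invg_continuous G y P Py).
  apply: filterS iP => z /= Pz.
  by apply: PQN => //; exact: nbhs_singleton.
move=> /(cly _ _ (FM n))[_ [[m /= nm <-] Nm]].
by exists ((u m)^-1 * x); split=> //; have [_ +] := uP m; exact: Bm.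
Qed.

End GroupTopology.

(** * Minimal displacement gives a factorization *)

Section Factorization.
Variable G : topologicalGroupType.
Implicit Types (a b : aut G) (x y : G) (A B C H V W : set G).

Definition stays a V : set G := [set x | forall k, V ((a ^+ k) x)].

Definition trunc a V n : set G :=
  [set x | forall k, (k <= n)%N -> V ((a^-1 ^+ k) x)].

Lemma stays_subgroup a V : is_subgroup V -> is_subgroup (stays a V).
Proof.
move=> sV; split=> [k|x y Vx Vy k|x Vx k]; rewrite ?aut1 ?autM ?autV.
- exact: subg1.
- exact: subgM (Vx k) (Vy k).
- exact: subgV (Vx k).
Qed.

Lemma trunc_subgroup a V n : is_subgroup V -> is_subgroup (trunc a V n).
Proof.
move=> sV; split=> [k kn|x y Vx Vy k kn|x Vx k kn]; rewrite ?aut1 ?autM ?autV.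
- exact: subg1.
- exact: subgM (Vx k kn) (Vy k kn).
- exact: subgV (Vx k kn).
Qed.

Lemma trunc0 a V : trunc a V 0 = V.
Proof.
apply/seteqP; split=> x; first by move=> /(_ 0 isT).
by move=> Vx k; rewrite leqn0 => /eqP->.
Qed.

Lemma truncS a V n : trunc a V n.+1 = V `&` [set x | trunc a V n (a^-1 x)].
Proof.
apply/seteqP; split=> x.
  move=> Vx; split; first exact: (Vx 0).
  by move=> k kn; rewrite -autXSr; exact: Vx.
by move=> [Vx Vax] [//|k] kn; rewrite autXSr; exact: Vax.
Qed.

Lemma trunc_le a V m n : (m <= n)%N -> trunc a V n `<=` trunc a V m.
Proof. by move=> mn x Vx k km; apply: Vx; exact: leq_trans mn. Qed.

Lemma trunc_sub a V n : trunc a V n `<=` V.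
Proof. by move=> x /(_ 0 isT). Qed.

Lemma stays_sub a V : stays a V `<=` V.
Proof. by move=> x /(_ 0). Qed.

Lemma staysX a V x n : stays a V x -> stays a V ((a ^+ n) x).
Proof. by move=> Vx k; rewrite -autXD. Qed.

Lemma cos_closed V : compact_open_subgroup V -> closed V.
Proof. by move=> [sV _ oV]; exact: open_subgroup_closed. Qed.

Lemma cosI V W : compact_open_subgroup V -> compact_open_subgroup W ->
  compact_open_subgroup (V `&` W).
Proof.
move=> cV cW; have clW := cos_closed cW.
case: cV cW => [sV cV oV] [sW _ oW]; split; first exact: subgroupI.
  exact: compact_closedI.
exact: openI.
Qed.

Lemma cos_preim a V : compact_open_subgroup V ->
  compact_open_subgroup [set x | V (a x)].
Proof.
move=> [sV cV oV]; split; first exact: subgroup_preim.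
  exact: compact_preim.
exact: open_preim.
Qed.

Lemma cos_trunc a V n : compact_open_subgroup V ->
  compact_open_subgroup (trunc a V n).
Proof.
move=> cV; elim: n => [|n IH]; first by rewrite trunc0.
by rewrite truncS; apply: cosI => //; exact: cos_preim.
Qed.

Lemma closed_stays a V : closed V -> closed (stays a V).
Proof.
move=> cV; have -> : stays a V = \bigcap_k [set x | V ((a ^+ k) x)].
  by apply/seteqP; split=> x Vx k; [move=> _; exact: Vx | exact: Vx].
by apply: closed_bigI => k _; exact: closed_preim.
Qed.

(** The index [[a(V) : a(V) cap V]] is at most [[a(W) : a(W) cap W]]; the sets
    [a(V)] and [a(W)] are written as preimages under [a^-1]. *)
Definition le_displacement a V W := forall s t,
  distinct_cosets [set x | V (a^-1 x)] V s -> covers [set x | W (a^-1 x)] W t ->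
  (size s <= size t)%N.

Lemma cos_covers V W : compact_open_subgroup V -> compact_open_subgroup W ->
  exists t, distinct_cosets V W t /\ covers V W t.
Proof.
move=> [_ cV _] [sW _ oW]; have [t ct] := compact_covers cV sW oW.
by have [s [ss cs _]] := covers_transversal sW ct; exists s.
Qed.

Section Minimal.
Variables (a : aut G) (V : set G).
Hypothesis cosV : compact_open_subgroup V.
Hypothesis minV : forall n, le_displacement a V (trunc a V n).

Let sV : is_subgroup V. Proof. by case: cosV. Qed.

(** Inequivalent elements of [a(V_n)] modulo [V_n] remain inequivalent modulo
    [V], since [a(V_n) cap V] is contained in [V_n]. By minimality a transversal
    of [a(V_n)] modulo [V_n] therefore meets all cosets of [V] in [a(V) V], so
    that [a(V)] is contained in [a(V_n) V] for all [n]. In the limit, [a(V)] is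
    contained in [a(V+) V]. *)
Lemma minimal_step x : V (a^-1 x) ->
  exists2 p, stays a^-1 V (a^-1 p) & V (p^-1 * x).
Proof.
move=> Vx; pose A n : set G := [set y | trunc a V n (a^-1 y)].
have AV n : forall x : G, V (a^-1 x) -> set_mulg (A n) V x.
  have cosVn := cos_trunc a n cosV.
  have [s [sA cA]] := cos_covers (cos_preim a^-1 cosVn) cosVn.
  have [t [tA tcA]] := cos_covers (cos_preim a^-1 cosV) cosV.
  have lets := minV tA cA.
  have sAV : distinct_cosets [set x | V (a^-1 x)] V s.
    case: sA => us sA sepA; split=> // [y ys|y z ys zs Vyz].
      exact: (@trunc_sub a V n _ (sA y ys)).
    apply: sepA => //; apply: (@trunc_le _ _ _ n.+1) => //; rewrite truncS.
    split=> //; rewrite /mkset autM autV.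
    by apply: subgVM (trunc_subgroup _ _ sV) (sA y ys) (sA z zs).
  have cs := distinct_covers sV sAV tcA lets.
  move=> y /cs[z zs Vz]; exists z; first by case: sA => _ /(_ z zs).
  by exists (z^-1 * y) => //; rewrite mulVKg.
have clV := cos_closed cosV.
have [p Ap [q Bq pq]] : set_mulg (\bigcap_n A n) (\bigcap_(_ in @setT nat) V) x.
  apply: compact_bigcap_mulg => //.
  - by have [] := cos_preim a^-1 (cos_trunc a 0 cosV).
  - by move=> n; apply: cos_closed; apply: cos_preim; exact: cos_trunc.
  - by move=> m n mn y; exact: trunc_le.
  - by move=> m n _ y.
  - by move=> n; exact: AV.
exists p; last by rewrite -pq mulKg; exact: (Bq 0).
by move=> k; have /(_ k (leqnn k)) := Ap k I.
Qed.

(** If [x = p q] with [q] in the [n]-th forward truncation of [V], factor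
    [a^(n+1) q] by [minimal_step] and push the first factor, which is in
    [a(V+)], back by [a^-(n+1)]: it lands in [V+], and the rest stays in [V] up
    to time [n + 1]. *)
Lemma minimal_trunc n x : V x -> set_mulg (stays a^-1 V) (trunc a^-1 V n) x.
Proof.
have sVp := stays_subgroup a^-1 sV.
move=> Vx; elim: n => [|n [p Vp [q Vq pq]]].
  by exists 1; [exact: (subg1 sVp) | exists x; rewrite ?trunc0 ?mul1g].
have [|r Vr Vrq] := @minimal_step (a ((a ^+ n) q)).
  by rewrite autK; have := Vq n (leqnn n); rewrite invgK.
pose r2 := (a^-1 ^+ n.+1) r.
have Vr2 : stays a^-1 V r2 by rewrite /r2 autXSr; exact: staysX.
exists (p * r2); first exact: (subgM sVp).
exists (r2^-1 * q); last by rewrite -pq !simplg.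
move=> k; rewrite invgK autM autV leq_eqVlt => /orP[/eqP->|kn].
  by rewrite autXKV autXS.
apply: subgVM => //; last by have := Vq k kn; rewrite invgK.
rewrite /r2 -{1}(subnKC kn) addSnnS autXDVl autXSr.
exact: Vr.
Qed.

Lemma minimal_factor x : V x -> set_mulg (stays a^-1 V) (stays a V) x.
Proof.
move=> Vx; have clV := cos_closed cosV.
have [p Ap [q Bq pq]] :
    set_mulg (\bigcap_(_ in @setT nat) stays a^-1 V) (\bigcap_n trunc a^-1 V n) x.
  apply: compact_bigcap_mulg => //.
  - apply: (@subclosed_compact _ _ V); [exact: closed_stays| |exact: stays_sub].
    by case: cosV.
  - by move=> n; exact: closed_stays.
  - by move=> n; apply: cos_closed; exact: cos_trunc.
  - by move=> m n _ y.
  - by move=> m n; exact: trunc_le.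
  - by move=> n; exact: minimal_trunc.
exists p; first exact: (Ap 0).
exists q => // k.
by have := Bq k I k (leqnn k); rewrite invgK.
Qed.

End Minimal.

End Factorization.

(** * Homoclinic elements *)

Section Homoclinic.
Variable G : topologicalGroupType.
Implicit Types (a b : aut G) (x y : G) (A B C H V W : set G).

Definition homoclinic a V : set G :=
  [set x | exists N, forall k, (N <= k)%N ->
     V ((a ^+ k) x) /\ V ((a^-1 ^+ k) x)].

Lemma homoclinic_subgroup a V : is_subgroup V -> is_subgroup (homoclinic a V).
Proof.
move=> sV; split=> [|x y [M xM] [N yN]|x [N xN]].
- by exists 0 => k _; rewrite !aut1; split; exact: subg1.
- exists (maxn M N) => k; rewrite geq_max => /andP[Mk Nk]; rewrite !autM.
  have [x1 x2] := xM k Mk; have [y1 y2] := yN k Nk.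
  by split; exact: subgM.
- exists N => k /xN[x1 x2]; rewrite !autV.
  by split; exact: subgV.
Qed.

Lemma homoclinic_aut a V x : homoclinic a V (a x) <-> homoclinic a V x.
Proof.
split=> -[N xN]; exists N.+1.
  move=> k Nk; split.
    case: k Nk => // k Nk; rewrite autXSr.
    by have [] := xN k Nk.
  by have [_] := xN k.+1 (leqW (ltnW Nk)); rewrite autXSr autK.
case=> // k Nk; split.
  by rewrite -autXSr; have [] := xN k.+2 (leqW (leqW Nk)).
by rewrite autXSr autK; have [] := xN k Nk.
Qed.

Lemma homoclinic_autX a V n x : homoclinic a V ((a ^+ n) x) <-> homoclinic a V x.
Proof.
elim: n => [//|n IH]; rewrite autXS.
exact: iff_trans (homoclinic_aut _ _ _) IH.
Qed.

Lemma homoclinic_autXV a V n x :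
  homoclinic a V ((a^-1 ^+ n) x) <-> homoclinic a V x.
Proof.
by apply: iff_sym; rewrite -{1}(autXKV a n x); exact: homoclinic_autX.
Qed.

(** The quotient of [a(V+)] by [V+] is finite; choose representatives [t] of
    the homoclinic classes in it, with forward orbits in [V] from time [N] on.
    If [x] is homoclinic with [x] in [a^(N+m+1)(V+)], then [x]
    differs from an element of [a^(N+m)(V+)] by a left factor in [a^(N+m)(t)],
    hence in [V-]. Descending to [m = 0] places [x] in [V- a^N(V+)], part of a
    compact set independent of [x]. *)
Lemma homoclinic_bounded a V : compact_open_subgroup V ->
  exists2 C, compact C & homoclinic a V `<=` C.
Proof.
move=> cosV; have [sV cV oV] := cosV.
have sL := homoclinic_subgroup a sV.
have sVm := stays_subgroup a sV; have sVp := stays_subgroup a^-1 sV.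
pose A := homoclinic a V `&` [set x | stays a^-1 V (a^-1 x)].
have [t0 [_ ct0]] := cos_covers (cos_preim a^-1 cosV) cosV.
have /(covers_transversal sV)[t [[_ tA _] cAt _]] : covers A V t0.
  by apply: covers_sub ct0 => x [_]; exact: stays_sub.
have [N tN] : exists N, forall y, y \in t -> forall k, (N <= k)%N -> V ((a ^+ k) y).
  have : forall y, y \in t -> homoclinic a V y by move=> y /tA[].
  elim: (t) => [_|y s IH ts]; first by exists 0.
  have [z zs|M sM] := IH; first by apply: ts; rewrite inE zs orbT.
  have [N yN] := ts y (mem_head _ _).
  exists (maxn M N) => z; rewrite inE => zs k; rewrite geq_max => /andP[Mk Nk].
  by case/orP: zs => [/eqP->|/sM]; [have [] := yN k Nk | exact].
have reduce m : forall x, homoclinic a V x -> stays a^-1 V ((a^-1 ^+ (N + m)) x) ->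
    exists2 u, stays a V u & V ((a^-1 ^+ N) (u^-1 * x)).
  elim: m => [|m IH] x Lx Vx.
    exists 1; first exact: (subg1 sVm).
    by rewrite invg1 mul1g -[N]addn0; exact: (Vx 0).
  pose y := (a^-1 ^+ (N + m)) x.
  have Ly : homoclinic a V y by apply/homoclinic_autXV.
  have Ay : A y by split=> //; rewrite /mkset /y -autXS -addnS.
  have [z zt Vzy] := cAt y Ay; have [Lz Vz] := tA z zt.
  have Vzy' : stays a^-1 V (z^-1 * y).
    case=> [//|k]; rewrite autXSr; move: k; apply: (_ : stays a^-1 V _).
    rewrite autM autV; apply: (subgVM sVp) => //.
    by rewrite /y -autXS -addnS.
  pose u1 := (a ^+ (N + m)) z.
  have Vu1 : stays a V u1.
    move=> k; rewrite /u1 -autXD; apply: tN => //.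
    by rewrite addnCA leq_addr.
  have [||u2 Vu2 Vux] := IH (u1^-1 * x).
  - apply: (subgVM sL) => //; exact/homoclinic_autX.
  - by rewrite autM autV /u1 autXVK.
  by exists (u1 * u2); [exact: (subgM sVm)|rewrite invgM -mulgA].
exists (set_mulg V [set x | V ((a^-1 ^+ N) x)]).
  by apply: compact_mulg => //; exact: compact_preim.
move=> x Lx; have [m xm] := Lx.
have [||u Vu Vux] := reduce m x => //.
  move=> k; rewrite -autXD; have [] // := xm (k + (N + m)).
  by rewrite addnA leq_addl.
exists u; first exact: stays_sub Vu.
by exists (u^-1 * x); rewrite ?mulVKg.
Qed.

(** The intersection of all [l V l^-1] with [l] in [L] is open because the
    conjugate depends only on the coset [l V], and finitely many of these cover
    [C]. *)
Lemma normalized_nbhs C L V : compact_open_subgroup V -> is_subgroup L ->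
  compact C -> L `<=` C ->
  exists W, [/\ compact_open_subgroup W, W `<=` V
    & forall l w, L l -> W w -> W (l * w * l^-1)].
Proof.
move=> cosV sL cC LC; have [sV cV oV] := cosV.
pose W : set G := [set w | forall l, L l -> V (l^-1 * w * l)].
have WV : W `<=` V.
  by move=> w /(_ 1 (subg1 sL)); rewrite !simplg.
have sW : is_subgroup W.
  split=> [l Ll|w z Ww Wz l Ll|w Ww l Ll].
  - by rewrite !simplg; exact: subg1.
  - by have := subgM sV (Ww l Ll) (Wz l Ll); rewrite !simplg.
  - by have := subgV sV (Ww l Ll); rewrite !simplg.
have oW : open W.
  apply: open_subgroup => //; have [t ct] := compact_covers cC sV oV.
  have : nbhs (1 : G) [set w | forall c, c \in t -> V (c^-1 * w * c)].
    elim: (t) => [|c s IH]; first by apply: filterS filterT => w _ c.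
    have Vc : nbhs (1 : G) [set w | V (c^-1 * w * c)].
      have H : nbhs (c^-1 * 1) [set w | V (w * c)].
        apply: (mulgr_continuous (y := c)); rewrite mulg1 mulVg.
        by apply: open_nbhs_nbhs; split=> //; exact: subg1.
      exact: (mulgl_continuous H).
    apply: filterS2 Vc IH => w Vw sw d; rewrite inE => /orP[/eqP->//|].
    exact: sw.
  apply: filterS => w tw l Ll; have [c ct' Vcl] := ct l (LC l Ll).
  have := subgM sV (subgM sV (subgV sV Vcl) (tw c ct')) Vcl.
  by rewrite !simplg.
exists W; split=> //.
  split=> //; apply: (@subclosed_compact _ _ V) => //.
  exact: open_subgroup_closed.
move=> l w Ll Ww m Lm.
by have := Ww _ (subgVM sL Ll Lm); rewrite !simplg.
Qed.

End Homoclinic.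

(** * Growth of displacement indices *)

Lemma exp_unbounded (a b C : nat) : (b < a)%N ->
  (forall j, a ^ j <= C * b ^ j)%N -> False.
Proof.
move=> ba aC.
(* Bernoulli's inequality for (1 + 1/b)^j, with denominators cleared *)
have bern j : (b ^ j * (b + j) <= b * b.+1 ^ j)%N.
  elim: j => [|j IH]; first by rewrite !expn0 addn0 mulnC.
  rewrite [in leqRHS]expnSr mulnA; apply: leq_trans (leq_mul IH (leqnn _)).
  rewrite expnSr -!mulnA leq_mul2l; apply/orP; right.
  by rewrite addnS !mulnS leq_add ?leq_addr // mulnC.
case: b => [|b] in ba aC bern *.
  by have := aC 1%N; rewrite expn1 exp0n // muln0 leqNgt ba.
have aj j : (b.+2 ^ j <= C * b.+1 ^ j)%N.
  by apply: leq_trans (aC j); case: j => // j; rewrite leq_exp2r.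
have := leq_trans (bern (C * b.+1)%N) (leq_mul (leqnn _) (aj _)).
rewrite mulnC [leqRHS]mulnCA mulnA leq_pmul2r ?expn_gt0 //.
by rewrite -[leqRHS]add0n leq_add2r.
Qed.

Section Growth.
Variable G : topologicalGroupType.
Implicit Types (a b : aut G) (x y : G) (A B C H V W : set G).

Lemma exists_minimal (P : set G -> Prop) a :
  (forall W, P W -> compact_open_subgroup W) -> (exists W, P W) ->
  exists2 W, P W & forall W', P W' -> le_displacement a W W'.
Proof.
move=> Pcos [W0 PW0].
pose Q n := `[< exists W t, [/\ P W, covers [set x | W (a^-1 x)] W t & size t = n] >].
have exQ : exists n, Q n.
  have [t [_ ct]] := cos_covers (cos_preim a^-1 (Pcos _ PW0)) (Pcos _ PW0).
  by exists (size t); apply/asboolP; exists W0, t.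
have [n /asboolP[W [t [PW ct tn]]] minn] := ex_minnP exQ.
exists W => // W' PW' s r ss cr.
have [sW _ _] := Pcos W PW.
apply: leq_trans (distinct_le_covers sW ss ct) _; rewrite tn; apply: minn.
by apply/asboolP; exists W', r.
Qed.

Lemma covers_autX a A H t n : covers A H t ->
  covers [set x | A ((a^-1 ^+ n) x)] [set x | H ((a^-1 ^+ n) x)]
    [seq (a ^+ n) y | y <- t].
Proof.
move=> cA x /cA[y yt Hy]; exists ((a ^+ n) y); first exact: map_f.
by rewrite /mkset autM autV autXVK.
Qed.

(** Submultiplicativity of the indices [[a^m(V) : a^m(V) cap V]]. *)
Lemma covers_pow a V n t : compact_open_subgroup V ->
  covers [set x | V ((a^-1 ^+ n) x)] V t ->
  forall j, exists2 r, covers [set x | V ((a^-1 ^+ (n * j)) x)] V r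
                     & size r = (size t ^ j)%N.
Proof.
move=> [sV _ _] ct; elim=> [|j [r cr rj]].
  exists [:: 1] => // x; rewrite /mkset muln0 => Vx.
  by exists 1; rewrite ?mem_head // invg1 mul1g.
have := covers_tower (@covers_autX a _ _ _ (n * j) ct) cr => cc.
eexists.
- apply: covers_sub cc => x; rewrite /mkset -autXD.
  by rewrite mulnS.
- by rewrite size_allpairs size_map rj -expnS.
Qed.

(** Each step of the chain [a^n(V), ..., V_n] obtained by intersecting
    successively with [a^(n-1)(V), ..., V] has index at most that of
    [a(V) cap V] in [a(V)]. *)
Lemma covers_trunc a V s : compact_open_subgroup V ->
  covers [set x | V (a^-1 x)] V s ->
  forall n, exists2 t, covers [set x | V ((a^-1 ^+ n) x)] (trunc a V n) t
                     & (size t <= size s ^ n)%N.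
Proof.
move=> cosV cs; have [sV _ _] := cosV; elim=> [|n [t ct tn]].
  exists [:: 1] => // x; rewrite /mkset trunc0 => Vx.
  by exists 1; rewrite ?mem_head // invg1 mul1g.
pose A : set G := [set x | trunc a V n (a^-1 x)].
have sA : is_subgroup A by apply: subgroup_preim; exact: trunc_subgroup.
have [r [[_ rA _] cr rs]] : exists r, [/\ distinct_cosets A V r, covers A V r
    & (size r <= size s)%N].
  apply: covers_transversal => //; apply: covers_sub cs => x.
  exact: (@trunc_sub _ a V n).
have cr' : covers A (trunc a V n.+1) r.
  move=> x Ax; have [y yr Vy] := cr x Ax; exists y => //.
  by rewrite truncS; split=> //; exact: (subgVM sA (rA y yr) Ax).
have cA := @covers_autX a _ _ _ 1 ct.
have := covers_tower cA cr' => cc.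
eexists.
- apply: covers_sub cc => x; rewrite /mkset -autXD.
  by rewrite addn1.
- by rewrite size_allpairs size_map expnSr leq_mul.
Qed.

(** Commensurable subgroups have displacement indices comparable up to a
    constant that depends neither on the automorphism nor on its power. *)
Lemma covers_compare V Z : compact_open_subgroup V -> compact_open_subgroup Z ->
  exists c : nat, forall a m t, covers [set x | V ((a^-1 ^+ m) x)] V t ->
    exists2 r, covers [set x | Z ((a^-1 ^+ m) x)] Z r & (size r = c * size t)%N.
Proof.
move=> cosV cosZ; have cosX := cosI cosV cosZ.
have [z [_ cz]] := cos_covers cosZ cosX; have [v [_ cv]] := cos_covers cosV cosX.
exists (size z * size v)%N => a m t ct.
have {}cv : covers V Z v by apply: covers_subr cv => x [].
have {}ct := covers_tower ct cv.
have {}ct : covers [set x | (V `&` Z) ((a^-1 ^+ m) x)] Z [seq x * y | x <- t, y <- v].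
  by apply: covers_sub ct => x [].
eexists; first exact: (covers_tower (@covers_autX a _ _ _ m cz) ct).
by rewrite !size_allpairs size_map -mulnA; congr (_ * _)%N; rewrite mulnC.
Qed.

Section Expansion.
Variables (a : aut G) (V : set G).
Hypothesis cosV : compact_open_subgroup V.

(** With [L] the homoclinic group, let [W] have minimal displacement among the
    compact open subgroups of [V] normalized by [L]; this class is stable under
    [W |-> W_n], so [W = W+ W-]. Put [Z = W L] and [Q = W+ L]. The key point is
    that [a^n(Q) cap Z] is contained in [Q]: an element of [a^n(W+)] of the form
    [w l], with [w] in [W-] and [l] in [L], has its orbit in [V] at all large
    times in both directions, hence is in [L]. As [Q] is contained in [a(Q)],
    the index of [Q] in [a^n(Q)] is the [n]-th power of that of [Q] in [a(Q)];
    by the key point these indices can be read off modulo [Z], and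
    [a(Z) = a(W+) a(W-) L] shows that representatives of [a(Q)] cover [a(Z)].
    The list [s] consists of such representatives. *)
Lemma exact_growth_subgroup : exists Z s, [/\ compact_open_subgroup Z,
  covers [set x | Z (a^-1 x)] Z s &
  forall n, exists2 r, distinct_cosets [set x | Z ((a^-1 ^+ n) x)] Z r
                     & size r = (size s ^ n)%N].
Proof.
pose L := homoclinic a V; have [sV _ _] := cosV.
have sL : is_subgroup L := homoclinic_subgroup a sV.
have [C cC LC] := homoclinic_bounded a cosV.
pose P W := [/\ compact_open_subgroup W, W `<=` V
    & forall l w, L l -> W w -> W (l * w * l^-1)].
have [|W [cosW WV LW] minW] := @exists_minimal P a _ (normalized_nbhs cosV sL cC LC).
  by move=> W [].
have [sW cW oW] := cosW.
have facW : forall x, W x -> set_mulg (stays a^-1 W) (stays a W) x.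
  apply: minimal_factor => // n; apply: minW; split.
  - exact: cos_trunc.
  - by move=> x /trunc_sub /WV.
  - move=> l w Ll Ww k kn; rewrite !autM autV; apply: LW; last exact: Ww.
    exact/homoclinic_autXV.
pose mulL A : set G := set_mulg A L.
have mulL_subgroup A : is_subgroup A -> (forall l w, L l -> A w -> A (l * w * l^-1)) ->
    is_subgroup (mulL A).
  move=> sA LA; split.
  - by exists 1; [exact: subg1|exists 1; [exact: subg1|rewrite mulg1]].
  - move=> _ _ [x Ax [l Ll <-]] [y Ay [m Lm <-]].
    exists (x * (l * y * l^-1)); first by apply: subgM => //; exact: LA.
    by exists (l * m); [exact: subgM|rewrite !simplg].
  - move=> _ [x Ax [l Ll <-]].
    exists (l^-1 * x^-1 * l^-1^-1); first by apply: LA; exact: subgV.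
    by exists l^-1; [exact: subgV|rewrite !simplg].
pose Z := mulL W; pose Q := mulL (stays a^-1 W).
have sWp := stays_subgroup a^-1 sW; have sWm := stays_subgroup a sW.
have sZ : is_subgroup Z by exact: mulL_subgroup.
have sQ : is_subgroup Q.
  apply: mulL_subgroup => // l w Ll Ww k; rewrite !autM autV; apply: LW => //.
  exact/homoclinic_autXV.
have QZ : Q `<=` Z.
  by move=> _ [x Wx [l Ll <-]]; exists x; [exact: stays_sub Wx|exists l].
have WZ : W `<=` Z.
  by move=> x Wx; exists x => //; exists 1; [exact: subg1|rewrite mulg1].
have LZ : L `<=` Z.
  by move=> x Lx; exists 1; [exact: subg1|exists x; rewrite ?mul1g].
have oZ : open Z.
  apply: open_subgroup => //; apply: filterS WZ _.
  by apply: open_nbhs_nbhs; split=> //; exact: subg1.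
have cosZ : compact_open_subgroup Z.
  split=> //; apply: subclosed_compact (compact_mulg cW cC) _.
    exact: open_subgroup_closed.
  by move=> _ [x Wx [l /LC Cl <-]]; exists x => //; exists l.
have Q_desc n x : Q x -> Q ((a^-1 ^+ n) x).
  move=> [y Wy [l Ll <-]]; rewrite autM; exists ((a^-1 ^+ n) y); first exact: staysX.
  by exists ((a^-1 ^+ n) l) => //; exact/homoclinic_autXV.
(* a^n(Q) cap Z is contained in Q *)
have QI n x : Q ((a^-1 ^+ n) x) -> Z x -> Q x.
  move=> [q Wq [k Lk qk]] [w Ww [l Ll wl]].
  have [p Wp [m Wm pm]] := facW w Ww.
  pose k' := (a ^+ n) k; pose q' := (a ^+ n) q.
  have Lk' : L k' by exact/homoclinic_autX.
  have xE : x = q' * k' by rewrite -autM qk autXKV.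
  pose y := p^-1 * q'.
  have yE : y = m * (l * k'^-1).
    by rewrite /y mulgA; apply: (mulgI p); rewrite !simplg pm wl xE !simplg.
  have Ly : L y.
    have [N lN] : L (l * k'^-1) by apply: subgM => //; exact: subgV.
    exists (maxn N n) => i; rewrite geq_max => /andP[Ni ni]; split.
      by rewrite yE autM; apply: subgM => //; [apply: WV; exact: Wm|have [] := lN i Ni].
    rewrite /y autM autV; apply: subgVM => //; first by apply: WV; exact: Wp.
    by rewrite -(subnK ni) /q' autXVD; apply: WV; exact: Wq.
  exists p => //; exists (y * k'); first exact: subgM.
  by rewrite /y xE !simplg.
have [_ cZ _] := cosZ.
have [s0 cs0] := compact_covers (compact_preim (a := a^-1) cZ) sZ oZ.
have [s [[us sQa sepQ] cs _]] : exists s, [/\ distinct_cosets [set x | Q (a^-1 x)] Z s,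
    covers [set x | Q (a^-1 x)] Z s & (size s <= size s0)%N].
  by apply: covers_transversal => //; apply: covers_sub cs0 => x; exact: QZ.
exists Z, s; split=> //.
  apply: (covers_mul cs _ sZ) => x [w Ww [l Ll wl]].
  have [p Wp [m Wm pm]] := facW w Ww.
  exists (a p).
    by rewrite /mkset autK; exists p => //; exists 1; [exact: subg1|rewrite mulg1].
  rewrite -[x](autVK a) -wl -pm !autM !simplg.
  apply: subgM => //; first by apply: WZ; exact: (Wm 1%N).
  by apply: LZ; exact/homoclinic_aut.
move=> n; suff [r [ur rQ sepr] rn] : exists2 r,
    distinct_cosets [set x | Q ((a^-1 ^+ n) x)] Z r & size r = (size s ^ n)%N.
  by exists r => //; split=> // x /rQ /QZ.
elim: n => [|n [r [ur rQ sepr] rn]].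
  exists [:: 1] => //; split=> // [x|x y]; rewrite !inE.
    by move=> /eqP->; rewrite /mkset aut1; exact: subg1.
  by move=> /eqP-> /eqP->.
(* representatives of a^(n+1)(Q) modulo a^n(Q), times those of a^n(Q) modulo Q *)
have sep_mul x y x' y' : x \in s -> y \in r -> x' \in s -> y' \in r ->
    Z (((a ^+ n) x * y)^-1 * ((a ^+ n) x' * y')) -> x = x' /\ y = y'.
  move=> xs yr xs' yr'; set z := (X in Z X) => Zz.
  have Qz : Q z.
    apply: (QI n.+1) => //.
    rewrite autXS /z !autM !autV !autM !autXVK.
    have Qa u : u \in r -> Q (a^-1 ((a^-1 ^+ n) u)).
      by move=> /rQ; exact: (Q_desc 1%N).
    by apply: subgVM => //; apply: subgM => //; by [exact: sQa|exact: Qa].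
  have xx' : x = x'.
    apply: sepQ => //; apply: QZ.
    have := Q_desc n _ Qz; rewrite /z !autM !autV !autM !autXVK => Qn.
    have := subgM sQ (subgM sQ (rQ y yr) Qn) (subgV sQ (rQ y' yr')).
    by rewrite !simplg.
  split=> //; apply: sepr => //; move: Zz; rewrite /z xx' !simplg //.
exists [seq (a ^+ n) x * y | x <- s, y <- r]; last by rewrite size_allpairs rn -expnS.
split.
- apply: allpairs_uniq => // -[x y] [x' y'] /= /allpairsP[[u v] [/= us' vr [-> ->]]].
  move=> /allpairsP[[u' v'] [/= us'' vr' [-> ->]]] e.
  have [|-> ->//] := sep_mul u v u' v' us' vr us'' vr'.
  by rewrite e mulVg; exact: subg1.
- move=> z /allpairsP[[x y] [/= xs yr ->]].
  rewrite /mkset autXS autM autXVK autM; apply: subgM => //; first exact: sQa.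
  by apply: (Q_desc 1%N); exact: rQ.
- move=> z z' /allpairsP[[x y] [/= xs yr ->]] /allpairsP[[x' y'] [/= xs' yr' ->]].
  by move=> /(sep_mul _ _ _ _ xs yr xs' yr')[-> ->].
Qed.

Hypothesis minV : forall W, compact_open_subgroup W -> le_displacement a V W.

(** If [x] is in [V cap a^n(V)] but not in [V_n], then a cover of [a^n(V)] by
    at most [t^n] cosets of [V_n] has two members in the same coset of [V], so
    one of them can be dropped modulo [V]. The indices for [V] along the
    multiples of [n] are then bounded by powers of a number less than [t^n],
    against the growth of [Z]. *)
Lemma minimal_convex n x : V x -> V ((a^-1 ^+ n) x) -> trunc a V n x.
Proof.
move=> Vx Vnx; apply: contrapT => ntx; have [sV _ _] := cosV.
have [Z [s [cosZ cs sepZ]]] := exact_growth_subgroup.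
have [r [sr cr]] := cos_covers (cos_preim a^-1 cosV) cosV.
have rs := minV cosZ sr cs.
have [t ct tr] := covers_trunc cosV cr n.
have sT := trunc_subgroup a n sV.
have [t' ct' tt'] : exists2 t', covers [set x | V ((a^-1 ^+ n) x)] V t'
    & (size t' < size s ^ n)%N.
  have [|u ut Tu] := ct 1; first by rewrite /mkset aut1; exact: subg1.
  have [v vt Tv] := ct x Vnx.
  have Tu' : trunc a V n u by move: Tu; rewrite mulg1; exact: subgVr.
  have Vu := trunc_sub Tu'.
  have uv : u != v.
    apply/eqP => uv; apply: ntx.
    by have := subgM sT Tu' Tv; rewrite uv mulVKg.
  have Vv : V v.
    have := subgM sV Vx (subgV sV (trunc_sub Tv)).
    by rewrite !simplg.
  exists (rem u t).
    move=> y /ct[w wt /trunc_sub Vw]; have [wu|wu] := eqVneq w u.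
      exists v; first by rewrite rem_mem // eq_sym.
      by have := subgM sV (subgVM sV Vv Vu) Vw; rewrite wu !simplg.
    by exists w => //; rewrite rem_mem.
  rewrite size_rem // prednK; last by case: (t) ut.
  by apply: leq_trans tr _; case: (n) => // k; rewrite leq_exp2r.
have [c cP] := covers_compare cosV cosZ.
apply: (exp_unbounded (C := c) tt') => j.
have [r1 cr1 r1j] := covers_pow cosV ct' j.
have [r2 cr2 r2E] := cP _ _ _ cr1.
have [r3 sr3 <-] : exists2 r3, distinct_cosets [set x | Z ((a^-1 ^+ (n * j)) x)] Z r3
   & size r3 = ((size s ^ n) ^ j)%N by rewrite -expnM; exact: sepZ.
rewrite -r1j -r2E; apply: distinct_le_covers sr3 cr2.
by case: cosZ.
Qed.
End Expansion.
End Growth.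

(** * Bounded orbits *)

Section BoundedOrbits.
Variable G : topologicalGroupType.
Implicit Types (a b : aut G) (x y : G) (A B C H V W : set G).

Definition bounded_orbit a x := exists2 C, compact C & forall k, C ((a ^+ k) x).

Lemma bounded_orbitM a x y :
  bounded_orbit a x -> bounded_orbit a y -> bounded_orbit a (x * y).
Proof.
move=> [C cC Cx] [D cD Dy]; exists (set_mulg C D); first exact: compact_mulg.
by move=> k; rewrite autM; exists ((a ^+ k) x) => //; exists ((a ^+ k) y).
Qed.

Lemma bounded_orbitV a x : bounded_orbit a x -> bounded_orbit a x^-1.
Proof.
move=> [C cC Cx]; exists [set y | C y^-1]; first exact: compact_invg.
by move=> k; rewrite autV /mkset invgK.
Qed.

Lemma stays_bounded_orbit a V x : compact V -> stays a V x -> bounded_orbit a x.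
Proof. by move=> cV Vx; exists V. Qed.

Lemma bounded_orbitX a b n x :
  (forall k, (a ^+ k) ((b ^+ n) x) = (b ^+ n) ((a ^+ k) x)) ->
  bounded_orbit a x -> bounded_orbit a ((b ^+ n) x).
Proof.
move=> ab [C cC Cx]; exists [set y | C ((b ^+ n)^-1 y)]; first exact: compact_preim.
by move=> k; rewrite ab /mkset autK.
Qed.

Definition convex a V := forall m k x,
  (k <= m)%N -> V x -> V ((a ^+ m) x) -> V ((a ^+ k) x).

Lemma convexV a V : convex a V -> convex a^-1 V.
Proof.
move=> cV m k x km Vx Vmx.
have := cV m (m - k)%N _ (leq_subr _ _) Vmx; rewrite autXKV => /(_ Vx).
by rewrite -{2}(subnK km) autXDVl.
Qed.

Lemma factorV a V : is_subgroup V ->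
  (forall x, V x -> set_mulg (stays a^-1 V) (stays a V) x) ->
  forall x, V x -> set_mulg (stays a V) (stays a^-1 V) x.
Proof.
move=> sV facV x Vx; have [v Vv [u Vu vu]] := facV _ (subgV sV Vx).
exists u^-1; first exact: (subgV (stays_subgroup a sV) Vu).
exists v^-1; first exact: (subgV (stays_subgroup a^-1 sV) Vv).
by rewrite -[x]invgK -vu invgM.
Qed.

(** Factor [x = v w] with [v] in [V-] and [w] in [V+]; then [v] too has a
    bounded backward orbit [y_k = a^-k v]. By recurrence there are a fixed [n]
    and arbitrarily large [m] with [z = y_n^-1 y_m] in [V]. As [a^m z] is in [V]
    because [v] is in [V-], convexity places [a^n z = v^-1 y_(m-n)] in [V], so
    the backward orbit of [v] visits [V] at arbitrarily late times, and by
    convexity it never leaves [V]. *)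
Lemma convex_bounded a V x : compact_open_subgroup V -> convex a V ->
  (forall x, V x -> set_mulg (stays a^-1 V) (stays a V) x) ->
  V x -> bounded_orbit a^-1 x -> stays a^-1 V x.
Proof.
move=> cosV cvxV facV Vx bx; have [sV cV oV] := cosV.
have sVp := stays_subgroup a^-1 sV.
have [v Vv [w Vw vw]] := factorV sV facV Vx.
have bv : bounded_orbit a^-1 v.
  have -> : v = x * w^-1 by rewrite -vw mulgK.
  apply: bounded_orbitM => //; apply: bounded_orbitV.
  exact: stays_bounded_orbit Vw.
have Vv0 : V v := Vv 0.
suff : stays a^-1 V v by move=> Vv'; rewrite -vw; exact: (subgM sVp).
have [C cC Cv] := bv.
have [n nP] := compact_recurrence cC sV oV Cv.
move=> p; have [m pm Vm] := nP (n + p)%N.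
have nm : (n <= m)%N by apply: leq_trans pm; exact: leq_addr.
have Vz : V ((a ^+ m) (((a^-1 ^+ n) v)^-1 * (a^-1 ^+ m) v)).
  rewrite autM autV autXKV -{1}(subnK nm) autXDV.
  exact: (subgVM sV (Vv _) Vv0).
have := cvxV m n _ nm Vm Vz.
rewrite autM autV autXKV -{1}(subnKC nm) autXDVl => /(subgM sV Vv0).
rewrite mulVKg => Vmn.
apply: (convexV cvxV (m := m - n) _ Vv0 Vmn).
by rewrite leq_subRL.
Qed.

(** The consequences of tidiness that survive intersections: factorization and
    capture of bounded orbits. *)
Record splits a V : Prop := Splits {
  splits_cos : compact_open_subgroup V ;
  splits_factor : forall x, V x -> set_mulg (stays a^-1 V) (stays a V) x ;
  splits_pos : forall x, V x -> bounded_orbit a^-1 x -> stays a^-1 V x ;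
  splits_neg : forall x, V x -> bounded_orbit a x -> stays a V x }.

(** The injection between sets of cosets provided by [tidy] sends the cosets of
    the elements of [s] to distinct cosets, each of which contains a
    representative equivalent to an element of [t]. *)
Lemma tidy_le_displacement a V W : tidy a V -> compact_open_subgroup W ->
  le_displacement a V W.
Proof.
move=> [cosV minV] cosW s t [us sA sepV] ct.
have [sV _ _] := cosV; have [sW _ _] := cosW.
have sVa : is_subgroup (a @` V `&` V).
  by rewrite aut_imageE; apply: subgroupI => //; exact: subgroup_preim.
have sWa : is_subgroup (a @` W `&` W).
  by rewrite aut_imageE; apply: subgroupI => //; exact: subgroup_preim.
have /pcard_leP/injfunPex[f fVW finj] := minV W cosW.
pose cosetV x : set G := [set x * h | h in a @` V `&` V].
pose cosetW x : set G := [set x * h | h in a @` W `&` W].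
have sV' x : x \in s -> displacement_cosets a V (cosetV x).
  by move=> /sA Vx; exists x => //; exists (a^-1 x) => //; rewrite autVK.
have [g gP] : {g : G -> G & forall x, x \in s -> g x \in t /\
   exists z, [/\ W (a^-1 z), W ((g x)^-1 * z) & f (cosetV x) = cosetW z]}.
  apply: (@choice _ _ (fun x y => x \in s -> y \in t /\
    exists z, [/\ W (a^-1 z), W (y^-1 * z) & f (cosetV x) = cosetW z])) => x.
  have [xs|xs] := boolP (x \in s); last by exists x.
  have [_ [z0 Wz0 <-] fz] := fVW _ (sV' x xs); set z := a z0 in fz.
  have Wz : W (a^-1 z) by rewrite /z autK.
  by have [y yt Wy] := ct z Wz; exists y => _; split=> //; exists z; split.
rewrite -(size_map g) uniq_leq_size //; last first.
  by move=> _ /mapP[x xs ->]; have [] := gP x xs.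
rewrite map_inj_in_uniq // => x y xs ys gxy; apply: sepV => //.
have [_ [z [Waz Wz fz]]] := gP x xs; have [_ [w [Waw Ww fw]]] := gP y ys.
have Wzw : (a @` W `&` W) (z^-1 * w).
  rewrite aut_imageE; split; first by rewrite /mkset autM autV; exact: subgVM.
  by have := subgVM sW Wz; rewrite gxy => /(_ _ Ww); rewrite !simplg.
have zw : cosetW z = cosetW w.
  apply/seteqP; split=> _ [h Wh <-].
    exists (w^-1 * z * h); last by rewrite !simplg.
    apply: subgM => //; have := subgV sWa Wzw.
    by rewrite !simplg.
  by exists (z^-1 * w * h); [exact: subgM|rewrite !simplg].
have /finj : f (cosetV x) = f (cosetV y) by rewrite fz fw.
rewrite !inE => /(_ (sV' x xs) (sV' y ys)) xy.
have : cosetV y y by exists 1; [exact: subg1|rewrite mulg1].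
by rewrite -xy => -[h [_ Vh] <-]; rewrite mulKg.
Qed.

Lemma tidy_splits a V : tidy a V -> splits a V.
Proof.
move=> tV; have [cosV _] := tV; have [sV cV oV] := cosV.
have minV W := @tidy_le_displacement a V W tV.
have facV : forall x, V x -> set_mulg (stays a^-1 V) (stays a V) x.
  by apply: minimal_factor => // n; apply: minV; exact: cos_trunc.
have cvxV : convex a^-1 V.
  by move=> m k x km Vx Vmx; exact: (minimal_convex cosV minV Vx Vmx km).
have cvxV' : convex a V by have := convexV cvxV; rewrite invgK.
split=> // x Vx bx; first exact: convex_bounded.
have := @convex_bounded a^-1 V x cosV cvxV; rewrite invgK; apply=> //.
exact: factorV.
Qed.

Lemma splits_bounded a V x : splits a V -> V x -> bounded_orbit a x ->
  bounded_orbit a^-1 x -> forall n, V ((a ^+ n) x) /\ V ((a^-1 ^+ n) x).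
Proof.
move=> gV Vx bx bx' n.
by split; [exact: (splits_neg gV Vx bx)|exact: (splits_pos gV Vx bx')].
Qed.

(** Given [x = v v' = w w'] with [v, w] in [V-, W-] and [v', w'] in [V+, W+],
    the element [g = w^-1 v = w' v'^-1] has a bounded two-sided orbit. By
    recurrence and capture for [V] there are arbitrarily large [q] such that
    [u = g^-1 a^q(g)] has its full orbit in [V]; hence
    [g = a^q(w)^-1 (a^q(v) u^-1)] lies in [a^p(W-) a^p(V-)] for all [p <= q], so
    for all [p], and in the limit [g = w0 v0] with the full orbits of [w0] and
    [v0] in [W] and [V]. Then [x = (v v0^-1) (v0 v')], where
    [v v0^-1 = w w0] and [v0 v' = w0^-1 w'] have the required property for both
    [V] and [W]. *)
Lemma splitsI a V W : splits a V -> splits a W -> splits a (V `&` W).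
Proof.
move=> gV gW; have [[sV cV oV] facV posV negV] := gV.
have [[sW cW oW] facW posW negW] := gW.
have sVm := stays_subgroup a sV; have sWm := stays_subgroup a sW.
have sVp := stays_subgroup a^-1 sV; have sWp := stays_subgroup a^-1 sW.
have clV := open_subgroup_closed sV oV; have clW := open_subgroup_closed sW oW.
have facVW : forall x, (V `&` W) x ->
    set_mulg (stays a (V `&` W)) (stays a^-1 (V `&` W)) x.
  move=> x [Vx Wx].
  have [v Vv [v' Vv' vx]] := factorV sV facV Vx.
  have [w Ww [w' Ww' wx]] := factorV sW facW Wx.
  pose g := w^-1 * v.
  have gE : g = w' * v'^-1.
    by apply: (mulgI w); apply: (mulIg v'); rewrite !simplg vx wx.
  have bg : bounded_orbit a g.
    apply: bounded_orbitM; last exact: stays_bounded_orbit Vv.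
    by apply: bounded_orbitV; exact: stays_bounded_orbit Ww.
  have bg' : bounded_orbit a^-1 g.
    rewrite gE; apply: bounded_orbitM; first exact: stays_bounded_orbit Ww'.
    by apply: bounded_orbitV; exact: stays_bounded_orbit Vv'.
  have [C cC Cg] := bg; have [n nP] := compact_recurrence cC sV oV Cg.
  have gp p : set_mulg [set y | stays a W ((a^-1 ^+ p) y)]
                       [set y | stays a V ((a^-1 ^+ p) y)] g.
    have [m pm Vm] := nP (n + p)%N.
    have nm : (n <= m)%N by apply: leq_trans pm; exact: leq_addr.
    have {}pm : (p <= m - n)%N by rewrite leq_subRL.
    set z := _ * _ in Vm.
    have bz : bounded_orbit a z.
      apply: bounded_orbitM; first apply: bounded_orbitV.
        by apply: bounded_orbitX => // k; rewrite -!autXD addnC.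
      by apply: bounded_orbitX => // k; rewrite -!autXD addnC.
    have comm i k (y : G) : (a^-1 ^+ k) ((a ^+ i) y) = (a ^+ i) ((a^-1 ^+ k) y).
      have [ik|/ltnW ki] := leqP i k.
        by rewrite -(subnK ik) autXVD addnC autXDVl.
      by rewrite -(subnKC ki) autXVDl addnC autXDV.
    have bz' : bounded_orbit a^-1 z.
      apply: bounded_orbitM; first apply: bounded_orbitV.
        by apply: bounded_orbitX => // k; exact: comm.
      by apply: bounded_orbitX => // k; exact: comm.
    have Vz := splits_bounded gV Vm bz bz'.
    pose q := (m - n)%N; pose u := (a^-1 ^+ n) z.
    have uE : u = g^-1 * (a ^+ q) g.
      by rewrite /u /z autM autV autXVK -{1}(subnKC nm) autXVDl.
    have Vu : stays a V ((a^-1 ^+ p) u).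
      move=> k; rewrite /u -autXD.
      have [ki|/ltnW ik] := leqP k (p + n).
        by rewrite -(subnKC ki) autXDVl; have [] := Vz (p + n - k)%N.
      by rewrite -(subnK ik) autXDV; have [] := Vz (k - (p + n))%N.
    exists ((a ^+ q) w^-1).
      rewrite /mkset /q -(subnKC pm) autXVDl; apply: staysX.
      exact: (subgV sWm Ww).
    exists ((a ^+ q) v * u^-1).
      rewrite /mkset autM autV; apply: (subgM sVm); last exact: (subgV sVm Vu).
      by rewrite /q -(subnKC pm) autXVDl; exact: staysX.
    by rewrite mulgA -autM -/g uE !simplg.
  have [w0 Ww0 [v0 Vv0 wv0]] : set_mulg (\bigcap_p [set y | stays a W ((a^-1 ^+ p) y)])
      (\bigcap_p [set y | stays a V ((a^-1 ^+ p) y)]) g.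
    have mono A m k : (m <= k)%N -> [set y | stays a A ((a^-1 ^+ k) y)] `<=`
        [set y | stays a A ((a^-1 ^+ m) y)].
      by move=> mk y /= /(staysX (k - m)); rewrite /= -{2}(subnKC mk) addnC autXDVl.
    apply: compact_bigcap_mulg => //.
    - by apply: (@subclosed_compact _ (stays a W) W) => //;
        [exact: closed_stays|exact: stays_sub].
    - by move=> k; apply: closed_preim; exact: closed_stays.
    - by move=> k; apply: closed_preim; exact: closed_stays.
    - by move=> m k; exact: mono.
    - by move=> m k; exact: mono.
  have Vv0' : stays a^-1 V v0 by move=> k; exact: (Vv0 k I 0).
  have Ww0' : stays a^-1 W w0 by move=> k; exact: (Ww0 k I 0).
  have {}Vv0 : stays a V v0 by exact: (Vv0 0).
  have {}Ww0 : stays a W w0 by exact: (Ww0 0).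
  exists (v * v0^-1).
    have e : v * v0^-1 = w * w0.
      by apply: (mulIg v0); rewrite mulgVK -mulgA wv0 /g mulVKg.
    move=> k; split; first by apply: (subgM sVm Vv (subgV sVm Vv0)).
    by rewrite e; apply: (subgM sWm Ww Ww0).
  exists (v0 * v'); last by rewrite !simplg.
  have e : v0 * v' = w0^-1 * w'.
    by apply: (mulgI w0); rewrite mulVKg mulgA wv0 gE mulgVK.
  move=> k; split; first by apply: (subgM sVp Vv0' Vv').
  by rewrite e; apply: (subgVM sWp Ww0' Ww').
have cosVW : compact_open_subgroup (V `&` W) by apply: cosI.
split=> //.
- have := @factorV a^-1 (V `&` W); rewrite invgK; apply=> //.
  by case: cosVW.
- by move=> x [Vx Wx] bx k; split; [exact: (posV x Vx bx)|exact: (posW x Wx bx)].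
- by move=> x [Vx Wx] bx k; split; [exact: (negV x Vx bx)|exact: (negW x Wx bx)].
Qed.

End BoundedOrbits.

(** * Products of subgroups in lexicographic order *)

Section SetProduct.
Variable G : groupType.

Lemma set_mulgA : associative (@set_mulg G).
Proof.
move=> A B C; apply/seteqP; split=> z.
  move=> [x Ax [_ [y By [w Cw <-]] <-]]; exists (x * y); first by exists x => //; exists y.
  by exists w; rewrite ?mulgA.
move=> [_ [x Ax [y By <-]] [w Cw <-]]; exists x => //.
by exists (y * w); rewrite ?mulgA //; exists y => //; exists w.
Qed.

Lemma set_mul1g : left_id [set 1] (@set_mulg G).
Proof.
move=> A; apply/seteqP; split=> z; first by move=> [_ -> [x Ax <-]]; rewrite mul1g.
by move=> Az; exists 1 => //; exists z; rewrite ?mul1g.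
Qed.

Lemma set_mulg1 : right_id [set 1] (@set_mulg G).
Proof.
move=> A; apply/seteqP; split=> z; first by move=> [x Ax [_ -> <-]]; rewrite mulg1.
by move=> Az; exists z => //; exists 1; rewrite ?mulg1.
Qed.

HB.instance Definition _ :=
  Monoid.isLaw.Build (set G) [set 1] (@set_mulg G) set_mulgA set_mul1g set_mulg1.

Lemma generated_subgroupP (A : set G) : is_subgroup (generated_subgroup A).
Proof.
split=> [H [sH _]|x y Hx Hy H HA|x Hx H HA].
- exact: subg1.
- by have [sH _] := HA; exact: subgM sH (Hx H HA) (Hy H HA).
- by have [sH _] := HA; exact: subgV sH (Hx H HA).
Qed.

Lemma sub_generated (A : set G) : A `<=` generated_subgroup A.
Proof. by move=> x Ax H [_]; exact. Qed.

Lemma subgX (H : set G) n x : is_subgroup H -> H x -> H (x ^+ n).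
Proof.
move=> sH Hx; elim: n => [|n IH]; first by rewrite expg0; exact: subg1.
by rewrite expgS; exact: subgM.
Qed.
End SetProduct.

(** The recursion on the first letter is the one by which the factors arise:
    the words starting with [false] all precede those starting with [true]. *)
Fixpoint lex_words n : seq (seq bool) :=
  if n is m.+1 then map (cons false) (lex_words m) ++ map (cons true) (lex_words m)
  else [:: [::]].

Lemma mem_lex_words n w : (w \in lex_words n) = (size w == n).
Proof.
elim: n w => [|n IH] [|b w] //=.
  by rewrite mem_cat; apply/negP => /orP[] /mapP[].
rewrite eqSS -IH mem_cat; case: b.
  rewrite mem_map; last by move=> ? ? [].
  by case: mapP => [[]|].
rewrite mem_map; last by move=> ? ? [].
by rewrite orbC; case: mapP => [[]|].
Qed.

Lemma signs_lexE n : map val (signs_lex n) = lex_words n.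
Proof.
pose r : rel (seq bool) := fun v w => ((v : seqlexi bool) <= w)%O.
have r_anti : antisymmetric r by exact: (@le_anti _ (seqlexi bool)).
have r_trans : transitive r by exact: (@le_trans _ (seqlexi bool)).
have r_cons b v w : r (b :: v) (b :: w) = r v w.
  exact: eqhead_lexiE.
apply: (sorted_eq r_trans r_anti).
- rewrite sorted_map; exact: (@sort_le_sorted _ (signs n) (enum {: signs n})).
- rewrite sorted_pairwise //; elim: n => [//|n IH] /=.
  rewrite pairwise_cat !pairwise_map.
  apply/and3P; split.
  + by apply/allrelP => _ _ /mapP[v _ ->] /mapP[w _ ->].
  + by apply: sub_pairwise IH => v w rvw; rewrite /= r_cons.
  + by apply: sub_pairwise IH => v w rvw; rewrite /= r_cons.
- apply: uniq_perm.
  + by rewrite map_inj_uniq ?sort_uniq ?enum_uniq //; exact: val_inj.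
  + elim: n => [//|n IH] /=; rewrite cat_uniq !map_inj_uniq ?IH /=.
    * by rewrite andbT; apply/hasPn => _ /mapP[v _ ->]; apply/mapP => -[].
    * by move=> ? ? [].
    * by move=> ? ? [].
  + move=> w; rewrite mem_lex_words; apply/mapP/eqP => [[v _ ->]|wn].
      exact: size_tuple.
    exists (Tuple (introT eqP wn)) => //.
    by rewrite mem_sort mem_enum.
Qed.

(** * The decomposition *)

Section Decomposition.
Variable G : topologicalGroupType.
Implicit Types (a b c : aut G) (x y : G) (l : seq (aut G)) (U V : set G).

(** The intersection of [U] with the subgroups [aut_plus b U] for [b] in the
    list [l] of automorphisms of a partial sign vector; unlike
    [aut_plus_inter], it is [U] for the empty list. *)
Definition cut U l : set G :=
  [set x | U x /\ forall b, b \in l -> stays b^-1 U x].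

Definition cut_trunc U l n : set G :=
  [set x | U x /\ forall b, b \in l -> trunc b U n x].

Lemma splits_trunc a b U n : (forall k, splits a [set x | U ((b^-1 ^+ k) x)]) ->
  splits a (trunc b U n).
Proof.
move=> gU; have gU0 : splits a U by exact: (gU 0).
elim: n => [|n IH]; first by rewrite trunc0.
have -> : trunc b U n.+1 = trunc b U n `&` [set x | U ((b^-1 ^+ n.+1) x)].
  apply/seteqP; split=> x.
    by move=> Ux; split; [exact: trunc_le Ux|exact: (Ux n.+1)].
  by move=> [Ux Unx] k; rewrite leq_eqVlt => /orP[/eqP->//|]; exact: Ux.
exact: splitsI.
Qed.

Lemma splits_cut_trunc a U l n : splits a U ->
  (forall b k, b \in l -> splits a [set x | U ((b^-1 ^+ k) x)]) ->
  splits a (cut_trunc U l n).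
Proof.
move=> gU; elim: l => [|b l IH] gl.
  by have -> : cut_trunc U [::] n = U by apply/seteqP; split=> x; [move=> []|].
have -> : cut_trunc U (b :: l) n = cut_trunc U l n `&` trunc b U n.
  apply/seteqP; split=> x.
    move=> [Ux lx]; split; last by apply: lx; rewrite mem_head.
    by split=> // c cl; apply: lx; rewrite inE cl orbT.
  by move=> [[Ux lx] bx]; split=> // c; rewrite inE => /orP[/eqP->|/lx].
apply: splitsI; last by apply: splits_trunc => k; apply: gl; rewrite mem_head.
by apply: IH => c k cl; apply: gl; rewrite inE cl orbT.
Qed.

(** The approximations [cut_trunc U l n] are finite intersections of sets
    [b^k(U)], so they split for [a]. The factors thus obtained lie in
    [stays a U] and [stays a^-1 U] because the approximations lie in [U], and
    compactness passes to the limit in [n]. *)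
Lemma cut_factor a U l : splits a U ->
  (forall b k, b \in l -> splits a [set x | U ((b^-1 ^+ k) x)]) ->
  cut U l = set_mulg (cut U (a^-1 :: l)) (cut U (a :: l)).
Proof.
move=> gU gl; have [sU cU oU] := splits_cos gU.
have cutE b : cut U (b :: l) = cut U l `&` stays b^-1 U.
  apply/seteqP; split=> x.
    move=> [Ux lx]; split; last by apply: lx; rewrite mem_head.
    by split=> // c cl; apply: lx; rewrite inE cl orbT.
  by move=> [[Ux lx] bx]; split=> // c; rewrite inE => /orP[/eqP->|/lx].
have scut : is_subgroup (cut U l).
  split.
  - by split=> [|b bl]; [exact: subg1|exact: (subg1 (stays_subgroup b^-1 sU))].
  - move=> x y [Ux lx] [Uy ly]; split=> [|b bl]; first exact: subgM.
    exact: (subgM (stays_subgroup b^-1 sU) (lx b bl) (ly b bl)).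
  - move=> x [Ux lx]; split=> [|b bl]; first exact: subgV.
    exact: (subgV (stays_subgroup b^-1 sU) (lx b bl)).
apply/seteqP; split=> x; last first.
  by rewrite !cutE => -[y [ly _] [z [lz _] <-]]; exact: subgM.
move=> lx; have gn n := splits_cut_trunc n gU gl.
have mono m n : (m <= n)%N -> cut_trunc U l n `<=` cut_trunc U l m.
  by move=> mn y [Uy ly]; split=> // b /ly; exact: trunc_le.
have stays_mono b V W : V `<=` W -> stays b V `<=` stays b W.
  by move=> VW y Vy k; exact: VW.
have cl n : closed (cut_trunc U l n) by apply: cos_closed; exact: splits_cos (gn n).
have cap b : \bigcap_n stays b (cut_trunc U l n) `<=` cut U l `&` stays b U.
  move=> y ly; split; last by move=> k; have [] := ly 0 I k.
  split; first by have [] := ly 0 I 0.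
  by move=> c cl' k; have [_ /(_ c cl' k (leqnn k))] := ly k I 0.
have [y ly [z lz yz]] : set_mulg (\bigcap_n stays a (cut_trunc U l n))
    (\bigcap_n stays a^-1 (cut_trunc U l n)) x.
  apply: compact_bigcap_mulg.
  - apply: (@subclosed_compact _ _ (cut_trunc U l 0)).
    + exact: closed_stays.
    + by case: (splits_cos (gn 0)).
    + exact: stays_sub.
  - by move=> n; exact: closed_stays.
  - by move=> n; exact: closed_stays.
  - by move=> m n mn; apply: stays_mono; exact: mono.
  - by move=> m n mn; apply: stays_mono; exact: mono.
  - move=> n; apply: factorV (splits_factor (gn n)) _ _.
      by case: (splits_cos (gn n)).
    by have [Ux lx'] := lx; split=> // b bl k _; exact: lx'.
exists y; first by rewrite cutE invgK; exact: cap.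
by exists z => //; rewrite cutE; exact: cap.
Qed.

Lemma eq_cut U l m : l =i m -> cut U l = cut U m.
Proof.
by move=> lm; apply/seteqP; split=> x [Ux lx]; split=> // b bl; apply: lx;
  rewrite ?lm // -lm.
Qed.

Definition signed (p : aut G * bool) := if p.2 then p.1 else p.1^-1.

Lemma cut_prod (H : set (aut G)) U (s l : seq (aut G)) : is_subgroup H ->
  (forall b, b \in l -> H b) -> (forall a, a \in s -> H a) ->
  (forall c a, H c -> a \in s -> splits a [set x | U (c x)]) ->
  cut U l = \big[@set_mulg G/[set 1]]_(w <- lex_words (size s))
              cut U ([seq signed p | p <- zip s w] ++ l).
Proof.
move=> sH; elim: s l => [|a s IH] l Hl Hs gU.
  by rewrite /= big_cons big_nil set_mulg1.
rewrite /= big_cat !big_map /=.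
have Ha : H a by apply: Hs; rewrite mem_head.
rewrite (@cut_factor a).
- congr set_mulg.
    rewrite (IH (a^-1 :: l)); last 3 first.
    + by move=> b; rewrite inE => /orP[/eqP->|/Hl//]; exact: subgV.
    + by move=> b bs; apply: Hs; rewrite inE bs orbT.
    + by move=> c b Hc bs; apply: gU => //; rewrite inE bs orbT.
    apply: eq_bigr => w _; apply: eq_cut => b.
    by rewrite !(inE, mem_cat) orbCA.
  rewrite (IH (a :: l)); last 3 first.
  + by move=> b; rewrite inE => /orP[/eqP->//|/Hl].
  + by move=> b bs; apply: Hs; rewrite inE bs orbT.
  + by move=> c b Hc bs; apply: gU => //; rewrite inE bs orbT.
  apply: eq_bigr => w _; apply: eq_cut => b.
  by rewrite !(inE, mem_cat) orbCA.
- by apply: (gU 1); [exact: subg1|rewrite mem_head].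
- move=> b k bl; apply: gU; last by rewrite mem_head.
  by apply: subgX => //; apply: subgV => //; exact: Hl.
Qed.

End Decomposition.

Theorem theorem4p6 (G : topologicalGroupType)
    (tdG : totally_disconnected [set: G]) (lcG : locally_compact [set: G])
    (n : nat) (n_gt0 : (0 < n)%N) (alpha : 'I_n -> aut G) (U : set G)
    (tidyU : invariably_tidy [set alpha j | j in [set: 'I_n]] U) :
  U = \big[@set_mulg G/[set 1]]_(e <- signs_lex n)
        aut_plus_inter (signed_auts alpha e) U
  /\ forall (j : 'I_n) (e : signs n),
       (signed_auts alpha e (alpha j) ->
          aut_plus_inter (signed_auts alpha e) U `<=`
            alpha j @` aut_plus_inter (signed_auts alpha e) U) /\
       (signed_auts alpha e (alpha j)^-1 ->
          alpha j @` aut_plus_inter (signed_auts alpha e) U `<=`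
            aut_plus_inter (signed_auts alpha e) U).
Proof.
pose D := generated_subgroup [set alpha j | j in [set: 'I_n]].
have sD : is_subgroup D by exact: generated_subgroupP.
have Da j : D (alpha j) by apply: sub_generated; exists j.
have gU c j : D c -> splits (alpha j) [set x | U (c x)].
  move=> Dc; rewrite -{1}(invgK c) -aut_imageE; apply: tidy_splits.
  by case: tidyU => _; apply; [exact: (subgV sD Dc)|exists j].
have [[sU cU oU] _] := tidyU.
have De e b : signed_auts alpha e b -> D b.
  by move=> [j _ <-]; case: (tnth e j) => //; exact: (subgV sD).
have interP e x : aut_plus_inter (signed_auts alpha e) U x <->
    forall b, signed_auts alpha e b -> stays b^-1 U x.
  split=> [ex b /ex bx k|ex b /ex bx k _]; last by rewrite autX_imageE; exact: bx.
  by have := bx k I; rewrite autX_imageE.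
split.
  pose s := [seq alpha j | j <- enum 'I_n].
  have ss : size s = n by rewrite size_map size_enum_ord.
  have sP a : a \in s -> exists j, a = alpha j by move=> /mapP[j _ ->]; exists j.
  transitivity (cut U [::]); first by apply/seteqP; split=> x // [].
  rewrite (@cut_prod _ D U s [::]) //; last 2 first.
  - by move=> a /sP[j ->].
  - by move=> c a Dc /sP[j ->]; exact: gU.
  rewrite ss -signs_lexE big_map; apply: eq_bigr => e _.
  have memE b : b \in [seq signed p | p <- zip s e] ++ [::] <-> signed_auts alpha e b.
    rewrite cats0 -[tval e](map_tnth_enum e) zip_map -map_comp.
    split=> [/mapP[j _ ->]|[j _ <-]]; first by exists j.
    by apply/mapP; exists j => //; rewrite mem_enum.
  apply/seteqP; split=> x; first by move=> [_ ex]; apply/interP => b /memE; exact: ex.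
  move=> /interP ex; split=> [|b /memE]; last exact: ex.
  pose j0 := Ordinal n_gt0.
  have := ex (if tnth e j0 then alpha j0 else (alpha j0)^-1) (ex_intro2 _ _ j0 I erefl).
  exact: stays_sub.
move=> j e.
have gX b k : signed_auts alpha e b -> splits (alpha j) [set x | U ((b^-1 ^+ k) x)].
  by move=> /De Db; apply: gU; apply: (subgX _ sD); exact: (subgV sD).
split=> ej x.
  move=> /interP ex; exists ((alpha j)^-1 x); last by rewrite autVK.
  apply/interP => b eb k.
  have bx := stays_bounded_orbit cU (ex _ ej).
  exact: (splits_pos (gX b k eb) (ex b eb k) bx 1%N).
move=> [y /interP ey <-]; apply/interP => b eb k.
have := ey _ ej; rewrite invgK => /(stays_bounded_orbit cU) bx.
exact: (splits_neg (gX b k eb) (ey b eb k) bx 1%N).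
Qed.
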